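(* Let $p$ be a prime, let $G$ be an extraspecial $p$-group of order $p^{2k+1}$ with $k\geq 1$, let $n$ be a positive integer and let $L$ be a non-empty subset of $G$. (a) Assume that $p$ is odd. (i) If $G\cong M_{p^3}^{\circ k}$, then $|N_{n,L}|\in\{0,\ 1,\ 2^{p^{2k}}-1,\ (2^{p^{2k}}-1)^2,\ \ldots,\ (2^{p^{2k}}-1)^p,\ 2^{p^{2k+1}}-1\}$. (ii) If $G\cong He_p^{\circ k}$, then $|N_{n,L}|\in\{0,\ 1,\ 2^{p^{2k+1}}-1\}$. Moreover, in both cases, $G\in\mathcal{D}$. (b) If $p=2$, then $|N_{n,L}|\in\{0,\ 1,\ 2^{4^k-2^k}-1,\ 2^{4^k+2^k}-1,\ (2^{4^k-2^k}-1)(2^{4^k+2^k}-1),\ 2^{2^{2k+1}}-1\}$. Moreover, $G\notin\mathcal{D}$.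
   Context: For a set $A$, $\mathcal{P}^*(A)$ denotes the set of all non-empty subsets of $A$. For a finite group $G$, $S\in\mathcal{P}^*(G)$ and a positive integer $n$, put $\mho^{\{n\}}(S)=\{s^n \mid s\in S\}$. For $L\in\mathcal{P}^*(G)$, $N_{n,L}$ denotes the set of all $S\in\mathcal{P}^*(G)$ such that $\mho^{\{n\}}(S)=L$. $\mathcal{D}$ is the class of all finite groups $G$ such that $|N_{n,L}|$ divides $|\mathcal{P}^*(G)|^{|L|}$ for every pair $(n,L)$ with $n$ a positive integer, $L\in\mathcal{P}^*(G)$ and $|N_{n,L}|\neq 0$. A finite $p$-group $G$ is called extraspecial if it has nilpotency class 2, $G'=Z(G)=\Phi(G)$ and $|G'|=p$, where $G'$ is the derived subgroup, $Z(G)$ the center and $\Phi(G)$ the Frattini subgroup. It is known that an extraspecial $p$-group has order $p^{2k+1}$ for some integer $k\geq 1$, and that: if $p$ is odd, then $G\cong M_{p^3}^{\circ k}$ or $G\cong He_p^{\circ k}$; if $p=2$, then $G\cong D_8^{\circ k}$ or $G\cong Q_8\circ D_8^{\circ(k-1)}$. Here $D_8$ is the dihedral group with 8 elements, $Q_8$ is the quaternion group of order 8, and, for $p$ odd, $$M_{p^3}=\langle x,y \mid x^{p^2}=y^p=1,\ y^{-1}xy=x^{p+1}\rangle,$$ $$He_p=\langle x,y,z \mid x^p=y^p=z^p=1,\ [x,z]=[y,z]=1,\ [x,y]=z\rangle.$$ $G\circ H$ denotes the central product of $G$ and $H$ with joint (identified) centers, and $G^{\circ k}$ is the central product of $k$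 copies of $G$, with $G^{\circ 1}=G$ and $G^{\circ 0}=\{1\}$ (so that $Q_8\circ D_8^{\circ 0}$ means $Q_8$). *)

(* Defs.v *)
From mathcomp Require Import all_boot all_fingroup all_solvable.

Set Implicit Arguments.
Unset Strict Implicit.
Unset Printing Implicit Defensive.

Import GroupScope.

Definition nepowerset (T : finType) (A : {set T}) : {set {set T}} :=
  powerset A :\ set0.

Definition powset (gT : finGroupType) (n : nat) (S : {set gT}) : {set gT} :=
  [set s ^+ n | s in S].

(* The set N_{n,L}, relative to the ambient group G. *)
Definition Npow (gT : finGroupType) (G : {group gT}) (n : nat) (L : {set gT}) :
    {set {set gT}} :=
  [set S in nepowerset G | powset n S == L].

Definition classD (gT : finGroupType) (G : {group gT}) : Prop :=
  forall (n : nat) (L : {set gT}), (0 < n)%N -> L \in nepowerset G ->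
    #|Npow G n L| <> 0%N ->
    (#|Npow G n L| %| #|nepowerset G| ^ #|L|)%N.

(* The next two lemmas check that the library groups 'Mod_(p ^ 3) and p^{1+2}
   have the textbook presentations of M_{p^3} and He_p. *)
Lemma Grp_Mp3 (p : nat) : prime p ->
  'Mod_(p ^ 3) \isog
    Grp (x : y : x ^+ (p ^ 2)%N, y ^+ p, y^-1 * x * y = x ^+ p.+1).
Proof.
move=> p_pr gT H; rewrite (@Grp_modular_group p 3 p_pr isT gT H) /= expn1.
by apply/existsP/existsP => -[[x y] /= Hxy]; exists (x, y);
  rewrite /= conjgE mulgA in Hxy *.
Qed.

Lemma Grp_He (p : nat) : prime p ->
  p^{1+2} \isog Grp (x : y : z : x ^+ p, y ^+ p, z ^+ p,
                     [~ x, z], [~ y, z], [~ x, y] = z).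
Proof.
move=> p_pr gT H; rewrite (Grp_pX1p2 p_pr H).
apply/existsP/existsP => /=.
  case=> -[x y] /=; rewrite !xpair_eqE.
  case/and3P=> /eqP defH xp /and3P[yp xyx xyy].
  have cx : commute x [~ x, y].
    by apply/commute_sym/commgP.
  have cy : commute y [~ x, y].
    by apply/commute_sym/commgP.
  exists (x, y, [~ x, y]); rewrite /= !xpair_eqE xp yp eqxx andbT /=.
  rewrite -(commXg p cx) (eqP xp) comm1g eqxx /=.
  apply/and3P; split; [|exact/commgP|exact/commgP].
  rewrite -defH joingC (joing_idPr _) // cycle_subG.
  by rewrite groupR // mem_gen // inE cycle_id ?orbT.
case=> -[[x y] z] /=; rewrite !xpair_eqE.
case/and5P=> /eqP defH xp yp _ /and3P[/commgP xz /commgP yz /eqP zE].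
exists (x, y); rewrite /= !xpair_eqE xp yp /= zE.
rewrite (introT commgP (commute_sym xz)) (introT commgP (commute_sym yz)) !andbT.
rewrite -defH eq_sym joingC (joing_idPr _) // cycle_subG.
by rewrite -zE groupR // mem_gen // inE cycle_id ?orbT.
Qed.

(* Main.v *)
(* Partitioning S by the fibres of x |-> x^n gives
   |N_{n,L}| = prod_(l in L) (2 ^ r(l) - 1), with r(l) the number of n-th roots
   of l. If p is odd, x |-> x^n is bijective on G or, when p divides n, a
   morphism into the center, so that r is constant on the n-th powers; as
   2^a - 1 divides 2^b - 1 exactly when a divides b, G lies in D.
   If p = 2, only squaring matters. It is a quadratic form on G / 'Z(G), and its
   Gauss sum over G has square 2 |G|, so r takes the two values 4^k + 2^k and
   4^k - 2^k on the center; the first does not divide |G|, so G is not in D. *)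

Require Import Defs.
From mathcomp Require Import all_boot all_fingroup all_solvable.
From mathcomp Require Import ssralg ssrnum ssrint.

Set Implicit Arguments.
Unset Strict Implicit.
Unset Printing Implicit Defensive.

Import GRing.Theory Num.Theory.

(** * Counting the sets with a prescribed image *)

Lemma card_nepowerset (T : finType) (A : {set T}) :
  #|nepowerset A| = (2 ^ #|A| - 1)%N.
Proof.
by rewrite cardsDS ?sub1set ?powersetE ?sub0set // card_powerset cards1.
Qed.

(** [S] is determined by its traces on the fibres over [L], and these may be any non-empty subsets
    of the fibres, chosen independently. For [L] empty the product is 1, yet no non-empty [S] has
    empty image. *)
Lemma card_set_imset_eq (T T' : finType) (f : T -> T') (A : {set T})
    (L : {set T'}) : L != set0 ->
  #|[set S in nepowerset A | f @: S == L]|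
    = (\prod_(l in L) (2 ^ #|[set x in A | f x == l]| - 1))%N.
Proof.
move=> L0; pose fib l := [set x in A | f x == l].
(* The default [set0] outside [L] puts the traces into [pfamily set0 L], where a family is counted
   by its values on [L]. *)
pose split_fib S := [ffun l => if l \in L then S :&: fib l else set0].
have subU S : S \in [set S in nepowerset A | f @: S == L] ->
    S = \bigcup_l split_fib S l.
  rewrite !inE => /andP[/andP[_ /subsetP SA] /eqP fS].
  apply/setP=> x; apply/idP/bigcupP => [xS | [l _]].
    by exists (f x); rewrite // ffunE -fS imset_f // !inE xS SA //=.
  by rewrite ffunE; case: ifP => _; [case/setIP | rewrite inE].
have /card_in_imset <- : {in [set S in nepowerset A | f @: S == L] &,
    injective split_fib}.
  by move=> S1 S2 S1N S2N eqS; rewrite (subU _ S1N) (subU _ S2N) eqS.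
transitivity #|pfamily set0 L (fun l => mem (nepowerset (fib l)))|; last first.
  rewrite card_pfamily foldrE big_image /=.
  by apply: eq_bigr => l _; rewrite -card_nepowerset; apply: eq_card.
apply: eq_card => h; apply/imsetP/pfamilyP => [[S] | [/supportP h0 hL]].
  rewrite inE => /andP[/setD1P[_]]; rewrite powersetE => /subsetP SA.
  move/eqP=> fS ->; split=> [|l lL].
    by apply/subsetP=> l; rewrite inE ffunE; case: ifP; rewrite // eqxx.
  rewrite ffunE lL !inE subsetIr andbT.
  move: lL; rewrite -fS => /imsetP[x xS ->].
  by apply/set0Pn; exists x; rewrite !inE xS SA /=.
have h_fib l x : x \in h l -> [/\ l \in L, x \in A & f x = l].
  have [lL | lL] := boolP (l \in L); last by rewrite h0 // inE.
  have /setD1P[_] := hL l lL; rewrite powersetE => /subsetP hl /hl.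
  by rewrite inE => /andP[-> /eqP].
exists (\bigcup_l h l); last first.
  apply/ffunP=> l; rewrite ffunE; case: ifP => [lL | /negbT/h0 //].
  apply/setP=> x; rewrite !inE; apply/idP/andP => [xh | [/bigcupP[l' _ xh]]].
    have [_ -> /eqP->] := h_fib _ _ xh; split=> //.
    by apply/bigcupP; exists l.
  by case/andP=> _ /eqP <-; have [_ _ ->] := h_fib _ _ xh.
have fh : f @: (\bigcup_l h l) = L.
  apply/setP=> l; apply/imsetP/idP => [[x /bigcupP[l' _ xh] ->] | lL].
    by have [? _ ->] := h_fib _ _ xh.
  have /setD1P[/set0Pn[x xh] _] := hL l lL.
  by have [_ _ <-] := h_fib _ _ xh; exists x => //; apply/bigcupP; exists l.
rewrite !inE fh eqxx andbT; apply/andP; split.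
  by apply: contraNneq L0 => h_0; rewrite -fh h_0 imset0.
by apply/bigcupsP=> l _; apply/subsetP=> x /h_fib[].
Qed.

(** * Fibres of the power map in a finite group *)

Section Roots.

Local Open Scope group_scope.

Variables (gT : finGroupType) (G : {group gT}).
Implicit Types (x y l : gT) (L : {set gT}) (n c : nat).

Definition nroots n l : {set gT} := [set x in G | x ^+ n == l].

Lemma nepowersetP L : reflect (L != set0 /\ L \subset G) (L \in nepowerset G).
Proof. by rewrite !inE; apply: andP. Qed.

Lemma card_Npow n L : L != set0 ->
  #|Npow G n L| = (\prod_(l in L) (2 ^ #|nroots n l| - 1))%N.
Proof. exact: card_set_imset_eq. Qed.

Lemma Npow_neq0_sub n L : #|Npow G n L| <> 0%N -> L \subset powset n G.
Proof.
move/eqP; rewrite cards_eq0 => /set0Pn[S]; rewrite !inE.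
by case/andP=> /andP[_ SG] /eqP <-; apply: imsetS.
Qed.

(** A non-zero count forces every element of [L] to be an n-th power, so all factors equal
    [2 ^ c - 1]. *)
Lemma card_Npow_const n c L : L != set0 ->
    {in G, forall x, #|nroots n (x ^+ n)| = c} ->
  #|Npow G n L| <> 0%N -> #|Npow G n L| = ((2 ^ c - 1) ^ #|L|)%N.
Proof.
move=> L0 cG /Npow_neq0_sub/subsetP LG; rewrite card_Npow // -prod_nat_const.
by apply: eq_bigr => l /LG/imsetP[x xG ->]; rewrite cG.
Qed.

Lemma card_powset_mul n c : {in G, forall x, #|nroots n (x ^+ n)| = c} ->
  (#|powset n G| * c)%N = #|G|.
Proof.
move=> cG; rewrite -[RHS]sum1_card (partition_big_imset (fun x => x ^+ n)) /=.
rewrite -sum_nat_const; apply: eq_bigr => l /imsetP[x xG ->].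
by rewrite -(cG x xG) -sum1_card; apply: eq_bigl => y; rewrite inE.
Qed.

Lemma card_nroots_coprime n : coprime #|G| n ->
  {in G, forall x, #|nroots n (x ^+ n)| = 1%N}.
Proof.
move=> co x xG; apply/eqP/cards1P; exists x; apply/setP=> y; rewrite !inE.
apply/andP/eqP => [[yG /eqP eq_xy] | -> //].
by rewrite -(expgK co yG) /= eq_xy (expgK co).
Qed.

Lemma card_nroots_expg1 n : {in G, forall x, x ^+ n = 1} ->
  {in G, forall x, #|nroots n (x ^+ n)| = #|G|}.
Proof.
move=> G1 x xG; rewrite G1 //; apply: eq_card => y; rewrite inE.
by apply: andb_idr => /G1->.
Qed.

(** The fibres of a morphism are the cosets of its kernel, here [nroots n 1]. *)
Lemma card_nroots_morph n :
    {in G &, forall x y, (x * y) ^+ n = x ^+ n * y ^+ n} ->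
  {in G, forall x, #|nroots n (x ^+ n)| = #|nroots n 1|}.
Proof.
move=> homn x xG; rewrite -(card_rcoset (nroots n 1) x).
apply: eq_card => y; rewrite mem_rcoset !inE groupMr ?groupV //.
apply: andb_id2l => yG; rewrite homn ?groupV // expgVn.
by rewrite -eq_mulgV1.
Qed.

End Roots.

(** * Power maps in an extraspecial p-group *)

Section Extraspecial.

Local Open Scope group_scope.

Variables (gT : finGroupType) (G : {group gT}) (p : nat).
Hypotheses (pG : p.-group G) (esG : extraspecial G).

Let cardZ : #|'Z(G)| = p. Proof. exact: card_center_extraspecial pG esG. Qed.

Let p_pr : prime p. Proof. by rewrite -cardZ; case: esG. Qed.

Lemma extraspecial_commg_center x y :
  x \in G -> y \in G -> [~ x, y] \in 'Z(G).
Proof. by case: esG => -[_ <-] _ xG yG; rewrite derg1 mem_commg. Qed.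

(** In a p-group, p-th powers lie in the Frattini subgroup, which here is the center. *)
Lemma extraspecial_expg_center x : x \in G -> x ^+ p \in 'Z(G).
Proof.
case: esG => -[<- _] _ xG; rewrite (Phi_joing pG) mem_gen // inE -{2}(expn1 p).
by rewrite Mho_p_elt ?orbT // (mem_p_elt pG).
Qed.

Lemma extraspecial_center_expg z : z \in 'Z(G) -> z ^+ p = 1.
Proof. by rewrite -cardZ; apply: expg_cardG. Qed.

Lemma extraspecial_expMg n x y : x \in G -> y \in G ->
  (y * x) ^+ n = y ^+ n * x ^+ n * [~ x, y] ^+ 'C(n, 2).
Proof.
move=> xG yG; have /centerP[_ cxy] := extraspecial_commg_center xG yG.
by rewrite expMg_Rmul //; apply/commute_sym/cxy.
Qed.

(** If p divides n, the power map is a morphism into the center, so its image has order 1 or p; this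
    gives the last two values of [c]. Otherwise the map is injective and [c = 1]. *)
Lemma card_nroots_extraspecial_odd n k : odd p -> #|G| = (p ^ (2 * k + 1))%N ->
  exists2 c, {in G, forall x, #|nroots G n (x ^+ n)| = c} &
    [\/ c = 1%N, c = (p ^ (2 * k + 1))%N
       | c = (p ^ (2 * k))%N /\ powset n G \subset 'Z(G)].
Proof.
move=> p_odd oG; have [/dvdnP[m def_n] | np] := boolP (p %| n); last first.
  exists 1%N; last exact: Or31.
  by apply: card_nroots_coprime; rewrite oG coprimeXl // prime_coprime.
pose c := #|nroots G n 1|.
have imZ : powset n G \subset 'Z(G).
  apply/subsetP=> _ /imsetP[x xG ->]; rewrite def_n mulnC expgM.
  by rewrite groupX ?extraspecial_expg_center.
have constG : {in G, forall x, #|nroots G n (x ^+ n)| = c}.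
  apply: card_nroots_morph => x y xG yG; rewrite extraspecial_expMg //.
  (* As [2 * 'C(n, 2) = n * (n - 1)] and p is odd, p divides ['C(n, 2)], which kills the commutator
     term. *)
  have /dvdnP[q ->] : p %| 'C(n, 2).
    have p2 : coprime p 2 by rewrite coprimen2.
    rewrite -(Gauss_dvdr _ p2) -(mul_bin_diag n 1) def_n.
    by rewrite dvdn_mulr ?dvdn_mull.
  rewrite mulnC expgM.
  rewrite (extraspecial_center_expg (extraspecial_commg_center _ _)) //.
  by rewrite expg1n mulg1.
have oIc := card_powset_mul constG; have p1 := prime_gt1 p_pr.
exists c => //.
have leIp : #|powset n G| <= p by rewrite -cardZ subset_leq_card.
(* The image has order [p ^ j], at most p, so [j] is 0 or 1. *)
have /(dvdn_pfactor _ _ p_pr)[j _ oI] : #|powset n G| %| p ^ (2 * k + 1).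
  by rewrite -oG -oIc dvdn_mulr.
move: leIp oIc; rewrite oI -{2}(expn1 p) leq_exp2l // oG.
case: j {oI} => [|[|//]] _ def_c; first by rewrite mul1n in def_c; apply: Or32.
apply: Or33; split=> //; apply/eqP; rewrite -(eqn_pmul2l (prime_gt0 p_pr)).
by rewrite -expnS -addn1 -def_c expn1.
Qed.

End Extraspecial.

(** * Square roots in an extraspecial 2-group *)

Section ExtraspecialTwo.

Local Open Scope group_scope.

Variables (gT : finGroupType) (G : {group gT}).
Hypotheses (pG : 2.-group G) (esG : extraspecial G).

Let cardZ : #|'Z(G)| = 2. Proof. exact: card_center_extraspecial pG esG. Qed.

(** On the center, which has order 2, this is the non-trivial character. *)
Let chi (g : gT) : int := ((-1) ^+ (g != 1)%g)%R.

Lemma center_extraspecial2 : exists2 z, z != 1 & 'Z(G) = [set 1; z].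
Proof.
have /trivgPn[z zZ z1] : 'Z(G) != 1 by rewrite -cardG_gt1 cardZ.
exists z => //; apply/esym/eqP; rewrite eqEcard cardZ cards2 eq_sym z1 andbT.
by rewrite subUset !sub1set group1 zZ.
Qed.

Let chiM : {in 'Z(G) &, {morph chi : g h / g * h >-> (g * h)%R}}.
Proof.
have [z z1 defZ] := center_extraspecial2.
have zz : z * z = 1.
  by rewrite -expg2 (extraspecial_center_expg pG esG) // defZ set22.
move=> g h; rewrite defZ => /set2P[] -> /set2P[] ->;
  by rewrite ?mul1g ?mulg1 ?zz /chi ?eqxx ?z1.
Qed.

(** Orthogonality: [x |-> chi [~ w, x]] is a character of G, trivial exactly for central [w]. *)
Let sum_chi_commg w : w \in G ->
  (\sum_(x in G) chi [~ w, x] = if w \in 'Z(G) then #|G|%:R else 0)%R.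
Proof.
move=> wG; case: ifPn => [/centerP[_ cwG] | ].
  rewrite -sumr_const; apply: eq_bigr => x xG.
  by rewrite (eqP (introT commgP (cwG x xG))) /chi eqxx.
rewrite inE wG /= => /centP-wZ.
have /exists_inP[x0 x0G /negPf ntwx0] : [exists x in G, [~ w, x] != 1].
  apply: contraT => /exists_inPn cw; case: wZ => x xG.
  by apply/commgP; have := cw x xG; rewrite negbK.
(* Translation by [x0] changes the sign of every term. *)
set S := (LHS); suff /eqP : (S = - S)%R.
  by rewrite -addr_eq0 -mulr2n mulrn_eq0 => /eqP.
rewrite {1}/S (reindex_inj (mulIg x0)) -sumrN.
apply: eq_big => [x | x]; rewrite groupMr // => xG.
have wxZ := extraspecial_commg_center esG wG xG.
rewrite commgMJ; have /centerP[_ cx] := wxZ.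
rewrite conjgE (cx _ x0G) mulKg chiM ?(extraspecial_commg_center esG) //.
by rewrite {1}/chi ntwx0 mulN1r.
Qed.

(* Substituting y = x w in the double sum over x and y makes it collapse onto
   the central w. *)
Lemma sqr_sum_chi : ((\sum_(x in G) chi (x ^+ 2)) ^+ 2 = (2 * #|G|)%:R)%R.
Proof.
have sqZ x : x \in G -> x ^+ 2 \in 'Z(G).
  exact: (extraspecial_expg_center pG esG).
rewrite expr2 big_distrl /=.
(* Here [(x * w) ^+ 2 = x ^+ 2 * w ^+ 2 * [~ w, x]], and the two factors [chi (x ^+ 2)] multiply to
   1. *)
transitivity (\sum_(x in G) \sum_(w in G) chi (w ^+ 2) * chi [~ w, x])%R.
  apply: eq_bigr => x xG; rewrite big_distrr /= (reindex_inj (mulgI x)) /=.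
  apply: eq_big => [w | w]; rewrite groupMl // => wG.
  have wxZ := extraspecial_commg_center esG wG xG.
  rewrite (extraspecial_expMg esG) // expg1.
  rewrite (chiM (groupM (sqZ x xG) (sqZ w wG)) wxZ).
  rewrite (chiM (sqZ x xG) (sqZ w wG)).
  by rewrite !mulrA -expr2 /chi sqrr_sign mul1r.
rewrite exchange_big /=.
rewrite (eq_bigr (fun w => if w \in 'Z(G) then #|G|%:R else 0)%R); last first.
  move=> w wG; rewrite -big_distrr /= sum_chi_commg //.
  case: ifP => wZ; last by rewrite mulr0.
  by rewrite (extraspecial_center_expg pG esG) // /chi eqxx mul1r.
rewrite -big_mkcondr /= (eq_bigl [in 'Z(G)]); last first.
  by move=> w; rewrite andb_idl // => /setIP[].
by rewrite sumr_const cardZ natrM mulr_natl.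
Qed.

(** The sum of [chi (x ^+ 2)] is [2 * (a - 4 ^ k)] and its square is [4 * 4 ^ k], so [a - 4 ^ k] is
    [2 ^ k] up to a sign that depends on the isomorphism type of G. *)
Lemma card_nroots2_extraspecial2 k : #|G| = (2 ^ (2 * k + 1))%N ->
  let a := #|nroots G 2 1| in
  a = (4 ^ k + 2 ^ k)%N \/ a = (4 ^ k - 2 ^ k)%N.
Proof.
move=> oG a.
have oG2 : #|G| = (2 * 4 ^ k)%N by rewrite oG expnD mulnC expnM.
have sumE : (\sum_(x in G) chi (x ^+ 2) = a%:R * 2 - #|G|%:R)%R.
  pose B := [set x in G | x ^+ 2 != 1].
  have -> : #|G| = (a + #|B|)%N.
    rewrite -(cardsID [set x | x ^+ 2 == 1] G); congr (_ + _)%N;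
      by apply: eq_card => x; rewrite !inE // andbC.
  rewrite (bigID (fun x => x ^+ 2 == 1)) /=.
  rewrite (eq_bigr (fun=> 1%R)) => [|x /andP[_ x2]]; last by rewrite /chi x2.
  rewrite [X in (_ + X)%R](eq_bigr (fun=> (- 1)%R)) => [|x /andP[_ x2]];
    last by rewrite /chi x2.
  rewrite (eq_bigl [in nroots G 2 1]) => [|x]; last by rewrite inE.
  rewrite [X in (_ + X)%R](eq_bigl [in B]) => [|x]; last by rewrite inE.
  by rewrite !sumr_const natrD mulNrn mulr_natr mulr2n opprD addrA addrK.
have := sqr_sum_chi; rewrite sumE oG2.
have -> : (a%:R * 2 - (2 * 4 ^ k)%:R = 2 * (a%:R - (4 ^ k)%:R) :> int)%R.
  by rewrite natrM mulrBr mulrC.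
rewrite exprMn mulnA natrM => /(mulfI _) eq_a.
have /eqP : ((a%:R - (4 ^ k)%:R) ^+ 2 = ((2 ^ k)%:R : int) ^+ 2)%R.
  rewrite eq_a // -natrX -expnM mulnC expnM //.
rewrite eqf_sqr subr_eq subr_eq => /orP[]/eqP.
  by rewrite -natrD => /eqP; rewrite eqr_nat addnC => /eqP; left.
have le24 : 2 ^ k <= 4 ^ k.
  by rewrite -[4]/(2 ^ 2)%N -expnM leq_exp2l ?leq_pmull.
by rewrite addrC -natrB // => /eqP; rewrite eqr_nat => /eqP; right.
Qed.

Lemma card_nroots2_center z : z != 1 -> 'Z(G) = [set 1; z] ->
  #|nroots G 2 1| + #|nroots G 2 z| = #|G|.
Proof.
move=> z1 defZ; rewrite -(cardsID (nroots G 2 1) G).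
congr (_ + _); apply: eq_card => x; rewrite !inE; case xG: (x \in G) => //=.
have := extraspecial_expg_center pG esG xG; rewrite defZ => /set2P[] ->.
  by rewrite eq_sym (negPf z1) eqxx.
by rewrite z1 eqxx.
Qed.

(** Naming the two central elements by their root counts, which add up to [2 * 4 ^ k], treats both
    signs at once. *)
Lemma nroots2_extraspecial2 k : #|G| = (2 ^ (2 * k + 1))%N ->
  exists u v, let c i := #|nroots G 2 i| in
    [/\ u != v, 'Z(G) = [set u; v], c u = (4 ^ k + 2 ^ k)%N
      & c v = (4 ^ k - 2 ^ k)%N].
Proof.
move=> oG; have [z z1 defZ] := center_extraspecial2.
have le24 : 2 ^ k <= 4 ^ k.
  by rewrite -[4]/(2 ^ 2)%N -expnM leq_exp2l ?leq_pmull.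
have oG2 : #|G| = (4 ^ k + 4 ^ k)%N by rewrite oG addn1 expnS expnM mul2n addnn.
have := card_nroots2_center z1 defZ; rewrite oG2.
have [] := card_nroots2_extraspecial2 oG => def1; rewrite def1 => defz.
  exists 1, z; split=> //; first by rewrite eq_sym.
  by apply/eqP; rewrite -(eqn_add2l (4 ^ k + 2 ^ k)) defz -addnA subnKC.
exists z, 1; split; rewrite // 1?setUC //.
apply/eqP; rewrite -(eqn_add2l (4 ^ k - 2 ^ k)) defz.
by rewrite addnCA subnK.
Qed.

(** Squares are central, hence of order at most 2, so an even power depends only on n modulo 4. *)
Lemma expg_even_extraspecial2 n x : x \in G -> ~~ odd n ->
  x ^+ n = if odd n./2 then x ^+ 2 else 1.
Proof.
move=> xG /even_halfK def_n; have x2Z := extraspecial_expg_center pG esG xG.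
rewrite -[in LHS]def_n -mul2n expgM.
rewrite -(expg_mod _ (extraspecial_center_expg pG esG x2Z)) modn2.
by case: (odd _); rewrite ?expg1 ?expg0.
Qed.

Lemma card_Npow2_extraspecial2 k n (L : {set gT}) (c := 4 ^ k - 2 ^ k)
    (d := 4 ^ k + 2 ^ k) : #|G| = (2 ^ (2 * k + 1))%N -> L != set0 ->
    {in G, forall x, x ^+ n = x ^+ 2} ->
  #|Npow G n L| \in
    [:: 0; 1; 2 ^ c - 1; 2 ^ d - 1; (2 ^ c - 1) * (2 ^ d - 1)]%N.
Proof.
move=> oG L0 eqn2; have [u [v /= [uv defZ cu cv]]] := nroots2_extraspecial2 oG.
have [-> | /eqP/Npow_neq0_sub/subsetP LG]
  := eqVneq #|Npow G n L| 0%N; first by [].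
have LZ l : l \in L -> l \in [set u; v].
  move/LG=> /imsetP[x xG ->]; rewrite -defZ eqn2 //.
  exact: (extraspecial_expg_center pG esG xG).
have eq_nroots l : #|nroots G n l| = #|nroots G 2 l|.
  by apply: eq_card => x; rewrite !inE; apply: andb_id2l => /eqn2->.
rewrite card_Npow //.
(* Since [L] lies in the center, the product has at most two factors, one for [u] and one for [v],
   each present when the element is in [L]. *)
rewrite (eq_bigl (fun l => (l \in [set u; v]) && (l \in L))); last first.
  by move=> l; rewrite andb_idl // => /LZ.
rewrite big_mkcondr /= big_setU1 /= ?in_set1 // big_set1.
rewrite !eq_nroots cu cv -/c -/d.
by rewrite mulnC; do 2!case: ifP => _; rewrite ?mul1n ?muln1 !inE eqxx ?orbT.
Qed.

End ExtraspecialTwo.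

(** * Divisibility of numbers [2 ^ a - 1] and membership in the class D *)

Lemma dvdn_exp2_sub1 a b : (2 ^ a - 1 %| 2 ^ b - 1) = (a %| b).
Proof.
have dvd_mul c q : 2 ^ c - 1 %| 2 ^ (q * c) - 1.
  by rewrite mulnC expnM -[X in _ %| _ - X](exp1n q) subn_exp dvdn_mulr.
apply/idP/idP => [|/dvdnP[q ->] //].
(* For [a = 0] both sides say that [b = 0]. *)
have [-> | a_gt0] := posnP a.
  rewrite expn0 subnn !dvd0n subn_eq0.
  by rewrite -[X in _ <= X](expn0 2) leq_exp2l // leqn0.
rewrite {1}(divn_eq b a) expnD.
(* Used with [x = 2 ^ (b %/ a * a)] and [y = 2 ^ (b %% a)]: modulo [2 ^ a - 1] only [y - 1] is left,
   which is smaller and vanishes only when [a] divides [b]. *)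
have mulB1 x y : 0 < x -> 0 < y -> x * y - 1 = (x - 1) * y + (y - 1).
  by move=> x0 y0; rewrite mulnBl mul1n addnBA // subnK // leq_pmull.
rewrite mulB1 ?expn_gt0 // dvdn_addr ?dvdn_mulr // => le_ab.
apply: contraLR le_ab => nab; rewrite gtnNdvd //.
  by rewrite subn_gt0 -[X in X < _](expn0 2) ltn_exp2l // lt0n.
by rewrite ltn_sub2r ?ltn_exp2l ?ltn_pmod // -[X in X < _](expn0 2) ltn_exp2l.
Qed.

(** The witness is n = 2 with [L = [set u]]: membership would make [2 ^ k * (2 ^ k + 1)] divide a
    power of 2, though [2 ^ k + 1] is odd and exceeds 1. *)
Lemma not_classD_extraspecial2 (gT : finGroupType) (G : {group gT}) k :
  (2.-group G)%g -> extraspecial G -> 0 < k -> #|G| = (2 ^ (2 * k + 1))%N ->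
  ~ classD G.
Proof.
move=> pG esG k0 oG DG.
have [u [v /= [_ defZ cu _]]] := nroots2_extraspecial2 pG esG oG.
have uG : u \in G by apply: (subsetP (center_sub G)); rewrite defZ set21.
have cardN : #|Npow G 2 [set u]| = (2 ^ (4 ^ k + 2 ^ k) - 1)%N.
  by rewrite card_Npow ?big_set1 ?cu // -card_gt0 cards1.
have := DG 2 [set u] isT; rewrite cardN cards1 expn1 card_nepowerset.
rewrite dvdn_exp2_sub1.
have -> : #|G| = (2 ^ k * 2 ^ k.+1)%N.
  by rewrite oG addn1 -expnD addnS addnn mul2n.
have -> : (4 ^ k + 2 ^ k = 2 ^ k * (2 ^ k + 1))%N.
  by rewrite mulnDr muln1 -expnMn.
rewrite dvdn_pmul2l ?expn_gt0 // => dvd2k.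
have: 2 ^ k + 1 %| 1.
  rewrite -(@Gauss_dvdr _ (2 ^ k.+1)) ?muln1; last first.
    by rewrite coprimeXr // coprimen2 addn1 /= oddX negb_or -lt0n k0.
  apply: dvd2k.
    by rewrite !inE sub1set uG andbT -card_gt0 cards1.
  apply/eqP; rewrite subn_eq0 -ltnNge -[X in X < _](expn0 2) ltn_exp2l //.
  by rewrite muln_gt0 addn1 expn_gt0.
by rewrite dvdn1 addn1 eqSS expn_eq0.
Qed.

(** The order of G is [c] times the number of n-th powers, so [2 ^ c - 1] divides [2 ^ #|G| - 1];
    both are then raised to the power [#|L|]. *)
Lemma classD_extraspecial_odd (gT : finGroupType) (G : {group gT}) (p k : nat) :
  (p.-group G)%g -> extraspecial G -> odd p -> #|G| = (p ^ (2 * k + 1))%N ->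
  classD G.
Proof.
move=> pG esG p_odd oG n L _ /nepowersetP[L0 LG] N0.
have [c constG _] := card_nroots_extraspecial_odd pG esG n p_odd oG.
rewrite (card_Npow_const L0 constG N0) card_nepowerset dvdn_exp2r //.
by rewrite dvdn_exp2_sub1 -(card_powset_mul constG) dvdn_mull.
Qed.

(** * The possible values of the cardinal of N_{n,L} *)

Theorem theorem2p8 (p k n : nat) (gT : finGroupType) (G : {group gT})
    (L : {set gT}) :
  prime p -> 1 <= k -> 0 < n ->
  (p.-group G)%g -> extraspecial G -> #|G| = p ^ (2 * k + 1) ->
  L \in nepowerset G ->
  (odd p ->
     (G \isog [set: ncprod 'Mod_(p ^ 3) k]%g ->
        #|Npow G n L| \in
          [:: 0; 1]
          ++ [seq (2 ^ (p ^ (2 * k)) - 1) ^ j | j <- iota 1 p]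
          ++ [:: 2 ^ (p ^ (2 * k + 1)) - 1]) /\
     (G \isog [set: ncprod p^{1+2} k]%g ->
        #|Npow G n L| \in [:: 0; 1; 2 ^ (p ^ (2 * k + 1)) - 1]) /\
     (G \isog [set: ncprod 'Mod_(p ^ 3) k]%g \/
      G \isog [set: ncprod p^{1+2} k]%g ->
        classD G)) /\
  (p = 2 ->
     #|Npow G n L| \in
       [:: 0; 1;
           2 ^ (4 ^ k - 2 ^ k) - 1;
           2 ^ (4 ^ k + 2 ^ k) - 1;
           (2 ^ (4 ^ k - 2 ^ k) - 1) * (2 ^ (4 ^ k + 2 ^ k) - 1);
           2 ^ (2 ^ (2 * k + 1)) - 1] /\
     ~ classD G).
Proof.
move=> p_pr k0 n0 pG esG oG /nepowersetP[L0 LG].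
have case_coprime : coprime #|G| n -> #|Npow G n L| <> 0 -> #|Npow G n L| = 1.
  move=> con N0; rewrite (card_Npow_const L0 (card_nroots_coprime con) N0).
  by rewrite exp1n.
(* Only 1 is an n-th power, so [L] is its singleton and all non-empty subsets of G are counted. *)
have case_expg1 : {in G, forall x, (x ^+ n)%g = 1%g} -> #|Npow G n L| <> 0 ->
    #|Npow G n L| = 2 ^ (p ^ (2 * k + 1)) - 1.
  move=> G1 N0; rewrite (card_Npow_const L0 (card_nroots_expg1 G1) N0) oG.
  suff -> : #|L| = 1 by rewrite expn1.
  apply/eqP; rewrite eqn_leq card_gt0 L0 andbT -(cards1 (1%g : gT)).
  rewrite subset_leq_card // (subset_trans (Npow_neq0_sub N0)) //.
  by apply/subsetP=> _ /imsetP[x xG ->]; rewrite G1 // inE.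
(* The value 0 is in every list, so only the claims about D remain. *)
have [-> | /eqP N0] := eqVneq #|Npow G n L| 0.
  do !split=> // *; first exact: classD_extraspecial_odd pG esG _ oG.
  by subst p; apply: not_classD_extraspecial2 oG.
split=> [p_odd | p2].
  split; last split; last by move=> _;
    apply: classD_extraspecial_odd pG esG _ oG.
    move=> _; have [c constG c_all] :=
      card_nroots_extraspecial_odd pG esG n p_odd oG.
    have := card_Npow_const L0 constG N0.
    case: c_all => [-> | def_c | [-> imZ]] eqN.
    - by rewrite eqN exp1n.
    - rewrite case_expg1 ?mem_cat ?inE ?eqxx ?orbT // => x xG.
      (* With [c] equal to the order of G, the roots of 1 fill G and the power map is trivial. *)
      have /eqP : nroots G n (1 ^+ n)%g == G.
        rewrite eqEcard; apply/andP; split; last by rewrite constG // def_c oG.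
        by apply/subsetP=> y; rewrite inE => /andP[].
      by move/setP/(_ x); rewrite inE xG expg1n => /eqP.
    rewrite eqN !mem_cat; apply/orP; right; apply/orP; left.
    (* The exponent [#|L|] lies between 1 and p, as [L] is a non-empty subset of the center. *)
    apply: map_f; rewrite mem_iota card_gt0 L0 add1n ltnS.
    rewrite -(card_center_extraspecial pG esG) subset_leq_card //.
    exact: subset_trans (Npow_neq0_sub N0) imZ.
  (* G has exponent p, so the power map is trivial if p divides n and bijective otherwise. *)
  move/exponent_isog; rewrite exponent_pX1p2n // => expG.
  have [/dvdnP[m def_n] | np] := boolP (p %| n).
    rewrite case_expg1 ?inE ?eqxx ?orbT // => x xG.
    by rewrite def_n mulnC expgM -expG expg_exponent ?expg1n.
  by rewrite case_coprime // oG coprimeXl // prime_coprime.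
subst p; split; last exact: not_classD_extraspecial2 oG.
(* The power map is bijective for odd n, squaring for n congruent to 2 modulo 4, and trivial when 4
   divides n. *)
have [n_odd | n_even] := boolP (odd n).
  by rewrite case_coprime // oG coprimeXl // coprime2n.
have n_exp x : x \in G -> _ :=
  fun xG => expg_even_extraspecial2 pG esG xG n_even.
case: (odd n./2) n_exp => n_exp; last first.
  by rewrite case_expg1 // !inE eqxx !orbT.
have := card_Npow2_extraspecial2 pG esG oG L0 n_exp.
by rewrite !inE => /or4P[->|->|->|/orP[->|->]]; rewrite ?orbT.
Qed.
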